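(* Let $L\in\mathbb{N}$, $L\ge1$, and let $X=X_0,X_1,\dots,X_L=V$ and $Z_1,\dots,Z_L$ be Hilbert spaces. Let $\psi\colon V\to[0,\infty)$ be convex and sub-differentiable with $\psi(v)\le C\|v\|^p$ for all $v\in V$, for some $C>0$ and $p\ge1$. For $\ell\in\{1,\dots,L\}$ let $A_\ell\colon X_{\ell-1}\to Z_\ell$ be affine and continuous and let $\sigma_\ell\colon Z_\ell\to X_\ell$ be quasi-homogeneous. Then $$\mathcal{N}=\sigma_L\circ A_L\circ\dots\circ\sigma_1\circ A_1\colon X\to V$$ is quasi-homogeneous. Additionally, $\mathcal{R}=\psi\circ\mathcal{N}$ is relatively sub-differentiable.
   Context: A function $f\colon X\to V$ between Hilbert spaces is quasi-homogeneous if there exists a map $\mathcal{L}_f\colon X\to L(X,V)$ into the space $L(X,V)$ of bounded linear maps such that $\sup_{x\in X}\|\mathcal{L}_f(x)\|<\infty$ and $\sup_{x\in X}\|f(x)-\mathcal{L}_f(x)x\|<\infty$. $F\colon X\to\mathbb{R}$ is relatively sub-differentiable if there is $\phi\colon X\to[0,\infty)$ such that for every $x\in X$ there exists $r\in X^*$ with $F(x)+\langle r,u-x\rangle\le F(u)+\phi(u)$ for all $u\in X$. $\psi$ is sub-differentiable if its usual (global convex) subdifferential $\partial_0\psi(v)$ is non-empty at every $v\in V$. *)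

(* Defs.v *)
From HB Require Import structures.
From mathcomp Require Import all_boot all_order all_algebra.
From mathcomp Require Import all_classical all_reals all_analysis.
Import Order.TTheory GRing.Theory Num.Theory numFieldNormedType.Exports.

Set Implicit Arguments.
Unset Strict Implicit.
Unset Printing Implicit Defensive.

Local Open Scope classical_set_scope.
Local Open Scope ring_scope.

(* Real Hilbert spaces: complete normed modules whose norm comes from an inner
   product. *)
HB.mixin Record CompleteNormedModule_isHilbert (R : realType) H
    & CompleteNormedModule R H := {
  inner : {dot H for (@idfun R)} ;
  inner_norm : forall x : H, inner x x = `|x| ^+ 2
}.

#[short(type="hilbertType")]
HB.structure Definition Hilbert (R : realType) :=
  {H of CompleteNormedModule R H & CompleteNormedModule_isHilbert R H}.

Section definitions.
Context {R : realType}.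
Implicit Types X V Z : hilbertType R.

(* Operator norm, as an extended real: it is finite exactly when T is bounded. *)
Definition opnorm X V (T : {linear X -> V}) : \bar R :=
  ereal_sup [set (`|T x|)%:E | x in [set x | `|x| <= 1]].

(* Bounded linear maps are encoded as linear maps that are continuous; see
   linear_bounded_continuous. *)
Definition quasi_homogeneous X V (f : X -> V) : Prop :=
  exists Lf : X -> {linear X -> V},
    [/\ forall x, continuous (Lf x),
        (ereal_sup (range (fun x => opnorm (Lf x))) < +oo)%E &
        (ereal_sup (range (fun x => (`|f x - Lf x x|)%:E)) < +oo)%E].

Definition affine_map X Z (A : X -> Z) : Prop :=
  exists (T : {linear X -> Z}) (b : Z), forall x, A x = T x + b.

(* Elements of the dual are continuous linear maps into R^o. *)
Definition relatively_subdifferentiable X (F : X -> R) : Prop :=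
  exists2 phi : X -> R, (forall u, 0 <= phi u) &
    forall x, exists2 r : {linear X -> R^o}, continuous r &
      forall u, F x + r (u - x) <= F u + phi u.

Definition subdifferential V (psi : V -> R) (v : V) : set {linear V -> R^o} :=
  [set r | continuous r /\ forall u, psi v + r (u - v) <= psi u].

Definition subdifferentiable V (psi : V -> R) : Prop :=
  forall v, subdifferential psi v !=set0.

(* With layers numbered from 0,
   network k = sigma_(k-1) \o A_(k-1) \o ... \o sigma_0 \o A_0. *)
Fixpoint network (X Z : nat -> hilbertType R)
    (A : forall l, X l -> Z l) (sigma : forall l, Z l -> X l.+1) (k : nat) :
    X 0%N -> X k :=
  match k with
  | 0%N => idfun
  | l.+1 => sigma l \o A l \o network A sigma l
  end.

End definitions.

(* Main.v *)
(* Quasi-homogeneity is stable under composition, the surrogate of [g \o f] at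
   [x] being [Lg (f x) \o Lf x].  For the network [N] with surrogate [LN], the
   point [N x + LN x (u - x)] differs from [LN x u] only by the bounded defect
   [N x - LN x x].  Hence the subgradient inequality of [psi] at [N x], tested
   at that point, is controlled by [C * (K + M * |u|) ^ p], which does not
   depend on [x] and serves as [phi u] because [psi (N u)] is nonnegative. *)
Require Import Defs.
From HB Require Import structures.
From mathcomp Require Import all_boot all_order all_algebra.
From mathcomp Require Import all_classical all_reals all_analysis.
Import Order.TTheory GRing.Theory Num.Theory numFieldNormedType.Exports.
Local Open Scope classical_set_scope.
Local Open Scope ring_scope.

Lemma ereal_sup_lt_pinfty_exists (R : realType) (S : set (\bar R)) :
  (ereal_sup S < +oo)%E -> exists2 M : R, 0 <= M & forall y, S y -> (y <= M%:E)%E.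
Proof.
(* The supremum may be [-oo], as for empty [S]; [fine] then returns [0]. The maximum with [0] makes
   the bound nonnegative. *)
move=> S_lt; exists (Num.max 0 (fine (ereal_sup S))); first by rewrite le_max lexx.
move=> y /ereal_sup_ubound; case: (ereal_sup S) S_lt => [s|//|] _ yle.
  by rewrite (le_trans yle)// lee_fin le_max lexx orbT.
by rewrite (le_trans yle)// leNye.
Qed.

Lemma ler_norm_linear_ball (R : realType) (X V : normedModType R)
    (T : {linear X -> V}) (M : R) :
  (forall y, `|y| <= 1 -> `|T y| <= M) -> forall y, `|T y| <= M * `|y|.
Proof.
move=> TM y; have [->|y0] := eqVneq y 0; first by rewrite linear0 !normr0 mulr0.
have ny : 0 < `|y| by rewrite normr_gt0.
have := TM (`|y|^-1 *: y).
rewrite linearZ/= !normrZ normfV normr_id mulVf ?gt_eqF// => /(_ (lexx _)).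
by rewrite ler_pdivrMl// mulrC.
Qed.

Lemma continuous_linear_norm_le (R : realType) (X V : normedModType R)
    (T : {linear X -> V}) :
  continuous T -> exists2 M : R, 0 <= M & forall y, `|T y| <= M * `|y|.
Proof.
move=> /(_ 0)/continuous_linear_bounded/linear_boundedP [M0 [_ TM]].
(* [linear_boundedP] gives the bound for every constant strictly above [M0], whose sign is
   unknown. *)
exists (`|M0| + 1) => [|y]; first by rewrite addr_ge0.
by apply: TM; rewrite (le_lt_trans (ler_norm M0))// ltrDl.
Qed.

(** Real constants [M] and [K] replace the two extended suprema, so that later estimates are plain
    norm inequalities. *)
Lemma quasi_homogeneousP (R : realType) (X V : hilbertType R) (f : X -> V) :
  quasi_homogeneous f <->
  exists (Lf : X -> {linear X -> V}) (M K : R),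
    [/\ forall x, continuous (Lf x), 0 <= M, 0 <= K,
        forall x y, `|Lf x y| <= M * `|y| & forall x, `|f x - Lf x x| <= K].
Proof.
split=> [[Lf [Lc /ereal_sup_lt_pinfty_exists[M M0 LM]
    /ereal_sup_lt_pinfty_exists[K K0 LK]]]|[Lf [M [K [Lc M0 K0 LM LK]]]]].
  exists Lf, M, K; split=> // x.
    apply: ler_norm_linear_ball => y y1; rewrite -lee_fin.
    apply: le_trans (LM (opnorm (Lf x)) _); last by exists x.
    by apply: ereal_sup_ubound; exists y.
  by rewrite -lee_fin; apply: LK; exists x.
exists Lf; split=> //.
  apply: (@le_lt_trans _ _ M%:E); last exact: ltry.
  apply: ge_ereal_sup => _ [x _ <-]; apply: ge_ereal_sup => _ [y /= y1 <-].
  by rewrite lee_fin (le_trans (LM x y))// ler_piMr.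
apply: (@le_lt_trans _ _ K%:E); last exact: ltry.
by apply: ge_ereal_sup => _ [x _ <-]; rewrite lee_fin.
Qed.

Lemma quasi_homogeneous_id (R : realType) (X : hilbertType R) :
  quasi_homogeneous (@idfun X).
Proof.
apply/quasi_homogeneousP; exists (fun=> idfun : {linear X -> X}), 1, 0.
split=> // [x y|x y|x] /=; first exact: cvg_id.
  by rewrite mul1r.
by rewrite subrr normr0.
Qed.

(** The linear part is the surrogate at every point, so the defect is constantly [b]; it inherits
    continuity from [A] as [A - b]. *)
Lemma quasi_homogeneous_affine (R : realType) (X Z : hilbertType R)
    (A : X -> Z) : affine_map A -> continuous A -> quasi_homogeneous A.
Proof.
move=> [T [b AE]] Ac.
have Tc : continuous T.
  have -> : (T : X -> Z) = (fun x => A x - b).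
    by apply/funext => x; rewrite AE addrK.
  by move=> x; apply: cvgB; [exact: Ac|exact: cvg_cst].
have [M M0 TM] := continuous_linear_norm_le _ _ _ _ Tc.
apply/quasi_homogeneousP; exists (fun=> T), M, `|b|; split=> // x.
by rewrite AE addrAC subrr add0r.
Qed.

Lemma quasi_homogeneous_comp (R : realType) (X Z V : hilbertType R)
    (g : Z -> V) (f : X -> Z) :
  quasi_homogeneous g -> quasi_homogeneous f -> quasi_homogeneous (g \o f).
Proof.
move=> /quasi_homogeneousP[Lg [Mg [Kg [Lgc Mg0 Kg0 LMg LKg]]]].
move=> /quasi_homogeneousP[Lf [Mf [Kf [Lfc Mf0 Kf0 LMf LKf]]]].
apply/quasi_homogeneousP.
exists (fun x => Lg (f x) \o Lf x : {linear X -> V}), (Mg * Mf), (Kg + Mg * Kf).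
split=> [x y|||x y|x] /=.
- exact: continuous_comp (Lfc x y) (Lgc (f x) _).
- exact: mulr_ge0.
- by rewrite addr_ge0// mulr_ge0.
- by rewrite -mulrA (le_trans (LMg _ _))// ler_wpM2l.
(* The defect splits as the defect of [g] at [f x], at most [Kg], plus [Lg (f x)] applied to the
   defect of [f] at [x], at most [Mg * Kf]. *)
- rewrite -[g (f x)](subrK (Lg (f x) (f x))) -addrA -linearB.
  by rewrite (le_trans (ler_normD _ _))// lerD// (le_trans (LMg _ _))// ler_wpM2l.
Qed.

Lemma quasi_homogeneous_network (R : realType) (X Z : nat -> hilbertType R)
    (A : forall l, X l -> Z l) (sigma : forall l, Z l -> X l.+1) (k : nat) :
  (forall l, (l < k)%N -> quasi_homogeneous (A l)) ->
  (forall l, (l < k)%N -> quasi_homogeneous (sigma l)) ->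
  quasi_homogeneous (network A sigma k).
Proof.
elim: k => [|k IHk] Aqh sqh; first exact: quasi_homogeneous_id.
have lt_lk l : (l < k)%N -> (l < k.+1)%N by apply: ltnW.
apply: (@quasi_homogeneous_comp _ _ (Z k)); first exact: sqh.
apply: (@quasi_homogeneous_comp _ _ (X k)); first exact: Aqh.
by apply: IHk => l /lt_lk; [exact: Aqh|exact: sqh].
Qed.

Lemma relatively_subdifferentiable_comp (R : realType) (X V : hilbertType R)
    (psi : V -> R) (f : X -> V) (C p : R) :
  (forall v, 0 <= psi v) -> subdifferentiable psi -> 0 <= C -> 0 <= p ->
  (forall v, psi v <= C * `|v| `^ p) ->
  quasi_homogeneous f -> relatively_subdifferentiable (psi \o f).
Proof.
move=> psi0 psi_sub C0 p0 psiC.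
move=> /quasi_homogeneousP[Lf [M [K [Lfc M0 K0 LM LK]]]].
exists (fun u => C * (K + M * `|u|) `^ p) => [u|x].
  by rewrite mulr_ge0// powR_ge0.
have [r [rc rsub]] := psi_sub (f x).
(* As in a chain rule, the subgradient at [f x] is pulled back along [Lf x]. *)
exists (r \o Lf x : {linear X -> R^o}) => [y|u] /=.
  exact: continuous_comp (Lfc x y) (rc _).
have := rsub (f x + Lf x (u - x)); rewrite addrAC subrr add0r.
move=> /le_trans; apply; rewrite (le_trans (psiC _))// ler_wpDl// ler_wpM2l//.
apply: ge0_ler_powR => //; rewrite ?nnegrE ?addr_ge0 ?mulr_ge0//.
(* The test point regroups as [(f x - Lf x x) + Lf x u], with norms at most [K] and [M * |u|]. *)
by rewrite linearB addrCA addrC (le_trans (ler_normD _ _))// lerD.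
Qed.

Theorem theorem4p4 (R : realType) (L : nat) (hL : (1 <= L)%N)
    (X Z : nat -> hilbertType R)
    (psi : X L -> R) (C p : R)
    (psi_ge0 : forall v, 0 <= psi v)
    (psi_convex : convex_function [set: X L] psi)
    (psi_subdiff : subdifferentiable psi)
    (hC : 0 < C) (hp : 1 <= p)
    (psi_growth : forall v, psi v <= C * `|v| `^ p)
    (A : forall l : nat, X l -> Z l)
    (sigma : forall l : nat, Z l -> X l.+1)
    (A_affine : forall l : nat, (l < L)%N -> affine_map (A l))
    (A_continuous : forall l : nat, (l < L)%N -> continuous (A l))
    (sigma_qh : forall l : nat, (l < L)%N -> quasi_homogeneous (sigma l)) :
  quasi_homogeneous (network A sigma L) /\
  relatively_subdifferentiable (psi \o network A sigma L).
Proof.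
(* Affine maps and activations are handled alike, as [2 * L] quasi-homogeneous factors. *)
have net_qh : quasi_homogeneous (network A sigma L).
  apply: quasi_homogeneous_network => // l lL.
  by apply: quasi_homogeneous_affine; [exact: A_affine|exact: A_continuous].
split=> //; apply: (relatively_subdifferentiable_comp _ _ _ _ _ C p) => //.
- exact: ltW.
- exact: le_trans hp.
Qed.
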